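(* For $n\geq 6$, let $G=L(K_n)$ be the line graph of the complete graph $K_n$. Then $M_{\mathcal{Z}}(G)=Z_{\pm}(G)=\binom{n}{2}-n$.
   Context: For a simple graph $G$ on $\{1,\dots,N\}$: the graph of a real symmetric matrix $A$ is $G$ if for $i\neq j$, $A_{ij}\neq0$ iff $i\sim j$. $\mathcal{Z}$ is the family of real symmetric matrices all of whose nonzero off-diagonal entries share the same weak sign; $M_{\mathcal{Z}}(G)$ is the maximum nullity of a matrix in $\mathcal{Z}$ with graph $G$. $Z_{\pm}(G)$ denotes $Z_{\pm}(P_{\mathcal{Z}}(G))$, where $P_{\mathcal{Z}}(G)$ is the sign pattern with $P_{ii}=?$, $P_{ij}=-$ if $i\sim j$, $P_{ij}=0$ otherwise. Signed zero forcing game on a sign pattern $P$ (entries in $\{+,-,0,?\}$): each vertex is black or white; a white vertex may carry a marker $m(w)\in\{+,-\}$ ($m(w)=*$ if unmarked; markers vanish when a vertex is colored black). Initially a set $S$ is black, others white and unmarked. Write $\iota(+)=-$, $\iota(-)=+$, $s\cdot t=+$ if $s=t$ and $-$ otherwise. A move: let $u$ be black, or white with $P_{uu}\neq ?$; let $W$ be the set of white $w$ (possibly $w=u$) with $P_{uw}\in\{+,-\}$; $W_+=\{w\in W: m(w)=P_{uw}\}$, $W_-=\{w\in W: m(w)\neq *, m(w)\neq P_{uw}\}$, $W_*=\{w\in W:m(w)=*\}$. (a) If $W=\{w\}$, color $w$ black. (b) If $W_+=W$ or $W_-=W$, color all of $W$ black. (c) If $W_s\neq\emptyset$, $W_{\iota(s)}=\emptyset$,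 $W_*=\{w\}$, mark $w$ with $P_{uw}\cdot\iota(s)$. (d) If no white vertex is marked, any white vertex may be marked $+$. $S$ is a signed zero forcing set if some sequence of moves makes everything black; $Z_{\pm}(P)$ is the minimum size of such a set. *)

(* Defs.v *)
(** Mathematical Components; the reals are an arbitrary [R : realType]. *)
From Stdlib Require Import Relation_Operators.
From HB Require Import structures.
From mathcomp Require Import all_boot all_order all_algebra.
From mathcomp Require Import boolp reals.
Set Implicit Arguments.
Unset Strict Implicit.
Unset Printing Implicit Defensive.
Import Order.TTheory GRing.Theory Num.Theory.
Local Open Scope ring_scope.

(** * Simple graphs *)

Record sgraph := SGraph {
  vertex :> finType;
  adj : rel vertex;
  adj_sym : symmetric adj;
  adj_irr : irreflexive adj }.

Definition edge_set (G : sgraph) : {set {set G}} :=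
  [set e | [exists x : G, exists y : G, adj x y && (e == [set x; y])]].

Section LineGraph.
Variable G : sgraph.

Definition line_vertex : finType := {e : {set G} | e \in edge_set G}.

Definition line_adj : rel line_vertex :=
  fun e f => (e != f) && (val e :&: val f != set0).

Lemma line_adj_sym : symmetric line_adj.
Proof. by move=> e f; rewrite /line_adj eq_sym setIC. Qed.

Lemma line_adj_irr : irreflexive line_adj.
Proof. by move=> e; rewrite /line_adj eqxx. Qed.

Definition line_graph : sgraph := SGraph line_adj_sym line_adj_irr.
End LineGraph.

Section CompleteGraph.
Variable n : nat.

Definition complete_adj : rel 'I_n := fun i j => i != j.

Lemma complete_adj_sym : symmetric complete_adj.
Proof. by move=> i j; rewrite /complete_adj eq_sym. Qed.

Lemma complete_adj_irr : irreflexive complete_adj.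
Proof. by move=> i; rewrite /complete_adj eqxx. Qed.

Definition complete_graph : sgraph := SGraph complete_adj_sym complete_adj_irr.
End CompleteGraph.

(** * Maximum nullity over the family Z

    The vertices of [G] are numbered by [enum_val : 'I_#|G| -> G], so that the
    matrices with graph [G] live in ['M[R]_#|G|]. *)

Section MaxNullity.
Variable R : realType.

Definition has_graph (G : sgraph) (A : 'M[R]_#|G|) : Prop :=
  forall i j, i != j -> (A i j != 0) = adj (enum_val i) (enum_val j).

Definition in_Z (N : nat) (A : 'M[R]_N) : Prop :=
  A^T = A /\
  ((forall i j, i != j -> 0 <= A i j) \/ (forall i j, i != j -> A i j <= 0)).

Definition nullity (N : nat) (A : 'M[R]_N) : nat := \rank (kermx A).

Definition Z_nullity (G : sgraph) : pred nat := fun k =>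
  `[< exists A : 'M[R]_#|G|, [/\ in_Z A, has_graph A & nullity A = k] >].

Lemma Z_nullity_ex (G : sgraph) : exists k, Z_nullity G k.
Proof.
pose A : 'M[R]_#|G| := \matrix_(i, j) (adj (enum_val i) (enum_val j))%:R.
exists (nullity A); apply/asboolP; exists A; split=> //.
  split; first by apply/matrixP=> i j; rewrite !mxE adj_sym.
  by left=> i j _; rewrite mxE ler0n.
by move=> i j _; rewrite mxE pnatr_eq0 eqb0 negbK.
Qed.

Lemma Z_nullity_le (G : sgraph) k : Z_nullity G k -> (k <= #|G|)%N.
Proof. by case/asboolP=> A [_ _ <-]; apply: rank_leq_row. Qed.

Definition M_Z (G : sgraph) : nat :=
  ex_maxn (Z_nullity_ex G) (@Z_nullity_le G).
End MaxNullity.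

(** * Sign patterns and signed zero forcing *)

Inductive sign := Plus | Minus.

Definition bool_of_sign (s : sign) : bool := if s is Plus then true else false.
Definition sign_of_bool (b : bool) : sign := if b then Plus else Minus.
Lemma bool_of_signK : cancel bool_of_sign sign_of_bool.
Proof. by case. Qed.
HB.instance Definition _ := Equality.copy sign (can_type bool_of_signK).

Definition iota_sign (s : sign) : sign := if s is Plus then Minus else Plus.
Definition mul_sign (s t : sign) : sign := if s == t then Plus else Minus.

(** [Any] is the entry "?". *)
Inductive entry := Signed of sign | Zero | Any.

Definition entry_sign (x : entry) : option sign :=
  if x is Signed s then Some s else None.

Definition is_any (x : entry) : bool := if x is Any then true else false.

Definition pattern (T : finType) := T -> T -> entry.

(** The marker belongs to the colour [White], so it is lost on blackening;
    [White None] is an unmarked white vertex. *)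
Inductive colour := Black | White of option sign.

Section Forcing.
Variables (T : finType) (P : pattern T).

Definition state := {ffun T -> colour}.
Implicit Types (st : state) (u w : T) (s : sign).

Definition is_white st w : bool := if st w is White _ then true else false.
Definition marker st w : option sign := if st w is White m then m else None.

Definition init (S : {set T}) : state :=
  [ffun v => if v \in S then Black else White None].
Definition blacken st (W : {set T}) : state :=
  [ffun v => if v \in W then Black else st v].
Definition mark st w s : state :=
  [ffun v => if v == w then White (Some s) else st v].

Definition may_force st u : bool := ~~ is_white st u || ~~ is_any (P u u).

Definition W_all st u : {set T} :=
  [set w | is_white st w && (entry_sign (P u w) != None)].
Definition W_sign st u s : {set T} :=
  match s with
  | Plus => [set w in W_all st u | marker st w == entry_sign (P u w)]
  | Minus => [set w in W_all st u | (marker st w != None)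
                                    && (marker st w != entry_sign (P u w))]
  end.
Definition W_star st u : {set T} :=
  [set w in W_all st u | marker st w == None].

Inductive move st : state -> Prop :=
| move_single u w :
    may_force st u -> W_all st u = [set w] -> move st (blacken st [set w])
| move_same u s :
    may_force st u -> W_sign st u s = W_all st u ->
    move st (blacken st (W_all st u))
| move_mark u s w p :
    may_force st u -> W_sign st u s != set0 ->
    W_sign st u (iota_sign s) = set0 -> W_star st u = [set w] ->
    P u w = Signed p ->
    move st (mark st w (mul_sign p (iota_sign s)))
| move_start w :
    (forall v, marker st v = None) -> is_white st w ->
    move st (mark st w Plus).

Definition signed_zero_forcing (S : {set T}) : Prop :=
  exists2 st, clos_refl_trans state move (init S) st
            & forall v, st v = Black.

Definition szf_size : pred nat := fun k =>
  `[< exists2 S : {set T}, signed_zero_forcing S & #|S| = k >].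

Lemma szf_size_ex : exists k, szf_size k.
Proof.
exists #|[set: T]|; apply/asboolP; exists [set: T] => //.
by exists (init [set: T]); [apply: rt_refl | move=> v; rewrite ffunE inE].
Qed.

Definition Z_pm_pattern : nat := ex_minn szf_size_ex.
End Forcing.

Definition P_Z (G : sgraph) : pattern G := fun i j =>
  if i == j then Any else if adj i j then Signed Minus else Zero.

Definition Z_pm (G : sgraph) : nat := Z_pm_pattern (@P_Z G).

(* Main.v *)
(** Upper bound on the nullity: a kernel vector of a matrix in Z that vanishes
    on a signed zero forcing set vanishes everywhere, since, up to one global
    sign, the markers record the weak signs of its entries.  A kernel of
    dimension exceeding the size of the set contains a nonzero vector vanishing
    on it.

    Lower bound: the Gram matrix [B^T B] of the vertex-edge incidence matrix of
    [K_n] is nonnegative with graph [L(K_n)], and its rank is at most [n].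

    Forcing set: leave white the star of vertex 0 and the edge 12, which are
    [n] edges.  For [k >= 3], the only white edge at [k] is [0k], so the black
    edges 34, 35, 45 give the pairs among 03, 04, 05 opposite markers; since
    there are three, two of them turn black.  Now the edges [4k] force every
    other [0k] with [k >= 3], and the remaining triangle 01, 02, 12 dies by the
    same parity argument with the edges 03 (now black), 13 and 23. *)
Require Import Defs.
From Stdlib Require Import Relation_Operators.
From mathcomp Require Import all_boot all_order all_algebra.
From mathcomp Require Import boolp reals.
Set Implicit Arguments.
Unset Strict Implicit.
Unset Printing Implicit Defensive.
Import Order.TTheory GRing.Theory Num.Theory.

(** * The forcing moves on the pattern [P_Z G] *)

Section PZMoves.
Variable G : sgraph.
Implicit Types (st : state G) (u v w : G) (s : sign) (S W : {set G}).

Definition white_nbhd st u : {set G} := [set w | is_white st w && adj u w].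

Lemma entry_sign_PZ u w :
  entry_sign (P_Z u w) = if adj u w then Some Minus else None.
Proof. by rewrite /P_Z; case: eqVneq => [->|_]; rewrite ?adj_irr //; case: adj. Qed.

Lemma W_all_PZ st u : W_all (@P_Z G) st u = white_nbhd st u.
Proof. by apply/setP => w; rewrite !inE entry_sign_PZ; case: adj. Qed.

(** Every signed entry is [Minus], so a marker agrees with its entry exactly when it is [Minus];
    hence the flip by [iota_sign]. *)
Lemma W_sign_PZ st u s :
  W_sign (@P_Z G) st u s =
  [set w in white_nbhd st u | marker st w == Some (iota_sign s)].
Proof.
apply/setP => w; case: s; rewrite !inE entry_sign_PZ;
  case: (adj u w); rewrite ?andbF ?andbT //.
by case: (marker st w) => [[]|].
Qed.

Lemma may_force_PZ st u : may_force (@P_Z G) st u = ~~ is_white st u.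
Proof. by rewrite /may_force /P_Z eqxx orbF. Qed.

Lemma move_single_PZ st u w :
    ~~ is_white st u -> white_nbhd st u = [set w] ->
  move (@P_Z G) st (blacken st [set w]).
Proof. by move=> bu e; apply: (@move_single _ _ _ u); rewrite ?may_force_PZ ?W_all_PZ. Qed.

(** Two white neighbours with weights of the same sign can balance only with opposite signs. This is
    rule (c) taken with [iota_sign s]. *)
Lemma move_opposite_PZ st u v w s :
    ~~ is_white st u -> white_nbhd st u = [set v; w] ->
    marker st v = Some s -> marker st w = None ->
  move (@P_Z G) st (mark st w (iota_sign s)).
Proof.
move=> bu e mv mw.
have -> : iota_sign s = mul_sign Minus (iota_sign (iota_sign s)) by case: s {mv}.
have uw : adj u w.
  have: w \in white_nbhd st u by rewrite e !inE eqxx orbT.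
  by rewrite inE => /andP[].
apply: (@move_mark _ _ _ u).
- by rewrite may_force_PZ.
- apply/set0Pn; exists v; rewrite W_sign_PZ e !inE eqxx mv.
  by case: s {mv}.
- apply/setP => x; rewrite W_sign_PZ e !inE; apply/negP => /andP[/orP[]/eqP->];
    by rewrite ?mv ?mw; case: s {mv}.
- apply/setP => x; rewrite /W_star W_all_PZ e !inE.
  have [->|_] := eqVneq x w; first by rewrite orbT mw.
  by rewrite orbF; case: eqVneq => //= ->; rewrite mv.
- by rewrite /P_Z uw; case: eqVneq uw => // ->; rewrite adj_irr.
Qed.

Lemma move_same_PZ st u s :
    ~~ is_white st u ->
    {in white_nbhd st u, forall w, marker st w = Some s} ->
  move (@P_Z G) st (blacken st (white_nbhd st u)).
Proof.
move=> bu ms; rewrite -W_all_PZ; apply: (@move_same _ _ _ u (iota_sign s)).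
  by rewrite may_force_PZ.
rewrite W_sign_PZ W_all_PZ; apply/setP => w; rewrite inE.
by case e: (_ \in _) => //=; rewrite ms //; case: s {ms}.
Qed.

(** Neither end carries markers, so stages compose on black sets alone and each one may open with
    rule (d). *)
Definition szf_reach (S S' : {set G}) :=
  clos_refl_trans (state G) (move (@P_Z G)) (init S) (init S').

Lemma szf_reach_setT S : szf_reach S setT -> signed_zero_forcing (@P_Z G) S.
Proof. by exists (init setT) => // v; rewrite ffunE inE. Qed.

Lemma is_white_init S v : is_white (init S) v = (v \notin S).
Proof. by rewrite /is_white ffunE; case: (v \in S). Qed.

Lemma blacken_init S W : blacken (init S) W = init (S :|: W).
Proof. by apply/ffunP => v; rewrite !ffunE inE orbC; case: (v \in W). Qed.

Lemma szf_reach_single S u w :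
  u \in S -> [set v | adj u v] :\: S = [set w] -> szf_reach S (w |: S).
Proof.
move=> uS e; rewrite /szf_reach setUC -blacken_init; apply/rt_step/(@move_single_PZ _ u).
  by rewrite is_white_init negbK.
by rewrite -e; apply/setP => v; rewrite !inE is_white_init.
Qed.

Lemma white_nbhd_mark st w s u :
  is_white st w -> white_nbhd (mark st w s) u = white_nbhd st u.
Proof.
move=> ww; apply/setP => v; rewrite !inE; congr (_ && _).
by rewrite {1}/is_white ffunE; case: eqP => // ->.
Qed.

Lemma is_white_mark st w s u :
  is_white st w -> is_white (mark st w s) u = is_white st u.
Proof. by move=> ww; rewrite {1}/is_white ffunE; case: eqP => // ->. Qed.

(* The three pairs cannot all have opposite signs, so after marking [a], [b] and
   [c] receive equal markers. *)
Lemma szf_reach_triple S a b c uab uac ubc :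
    a != b -> a != c -> b != c -> uab \in S -> uac \in S -> ubc \in S ->
    [set v | adj uab v] :\: S = [set a; b] ->
    [set v | adj uac v] :\: S = [set a; c] ->
    [set v | adj ubc v] :\: S = [set b; c] ->
  szf_reach S ([set a; b; c] :|: S).
Proof.
move=> ab ac bc uabS uacS ubcS eab eac ebc.
have nbhdE u : white_nbhd (init S) u = [set v | adj u v] :\: S.
  by apply/setP => v; rewrite !inE is_white_init.
have [aS bS cS] : [/\ a \notin S, b \notin S & c \notin S].
  have hab x : x \in [set a; b] -> x \notin S by rewrite -eab inE => /andP[].
  have hac x : x \in [set a; c] -> x \notin S by rewrite -eac inE => /andP[].
  by split; [apply: hab|apply: hab|apply: hac]; rewrite !inE eqxx ?orbT.
pose st1 := mark (init S) a Plus.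
pose st2 := mark st1 b Minus; pose st3 := mark st2 c Minus.
have w1 v : is_white st1 v = (v \notin S) by rewrite is_white_mark is_white_init.
have w2 v : is_white st2 v = (v \notin S) by rewrite is_white_mark w1.
have w3 v : is_white st3 v = (v \notin S) by rewrite is_white_mark w2.
have n1 u : white_nbhd st1 u = [set v | adj u v] :\: S.
  by rewrite white_nbhd_mark ?is_white_init.
have n2 u : white_nbhd st2 u = [set v | adj u v] :\: S by rewrite white_nbhd_mark ?w1.
have n3 u : white_nbhd st3 u = [set v | adj u v] :\: S by rewrite white_nbhd_mark ?w2.
apply: (rt_trans _ _ _ st1).
  apply/rt_step/move_start; last by rewrite is_white_init.
  by move=> v; rewrite /marker ffunE; case: (_ \in _).
apply: (rt_trans _ _ _ st2).
  apply/rt_step/(@move_opposite_PZ _ uab a b Plus); rewrite ?n1 ?w1 ?negbK //.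
    by rewrite /marker !ffunE eqxx.
  by rewrite /marker !ffunE eq_sym (negPf ab) (negPf bS).
apply: (rt_trans _ _ _ st3).
  apply/rt_step/(@move_opposite_PZ _ uac a c Plus); rewrite ?n2 ?w2 ?negbK //.
    by rewrite /marker !ffunE (negPf ab) eqxx.
  by rewrite /marker !ffunE ![c == _]eq_sym (negPf ac) (negPf bc) (negPf cS).
apply: (rt_trans _ _ _ (blacken st3 [set b; c])).
  rewrite -ebc -n3; apply/rt_step/(@move_same_PZ _ ubc Minus); rewrite ?w3 ?negbK //.
  by move=> v; rewrite n3 ebc !inE /marker !ffunE => /orP[]/eqP->;
    rewrite ?eqxx ?(negPf bc).
(* Blackening [a] erases the last marker, which gives an unmarked state again. *)
have -> : init ([set a; b; c] :|: S) = blacken (blacken st3 [set b; c]) [set a].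
  apply/ffunP => v; rewrite !ffunE !inE.
  by case: (v == a); case: (v == b); case: (v == c).
apply/rt_step/(@move_single_PZ _ uab).
  by rewrite /is_white ffunE; case: ifP => // _; rewrite -/(is_white st3 uab) w3 negbK.
have /setP nb : white_nbhd st3 uab = [set a; b] by rewrite n3.
apply/setP => v; move: (nb v); rewrite !inE {2}/is_white ffunE !inE.
rewrite -/(is_white st3 v).
have [->|_] := eqVneq v a; first by rewrite (negPf ab) (negPf ac).
have [->|_] /= := eqVneq v b; first by [].
by case: (v == c).
Qed.

End PZMoves.

(** * Markers as weak signs of a kernel vector *)

Section NullityBound.
Local Open Scope ring_scope.
Variables (R : realType) (G : sgraph).

Definition sgn_val (s : sign) : R := if s is Plus then 1 else -1.

Lemma sgn_val_iota s : sgn_val (iota_sign s) = - sgn_val s.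
Proof. by case: s; rewrite /= ?opprK. Qed.

(* Markers are meaningful only up to a global sign [e], which is fixed by the
   first marker. *)
Definition compatible (x : G -> R) (st : state G) : Prop :=
  exists2 e : sign,
    (forall v, st v = Black -> x v = 0) &
    (forall v s, marker st v = Some s -> 0 <= sgn_val e * sgn_val s * x v).

(** [c] models the off-diagonal entries, made positive by a global sign. [balance] is the kernel
    equation of row [u], where [x u = 0] cancels the diagonal entry. *)
Variables (x : G -> R) (c : G -> G -> R).
Hypothesis c_gt0 : forall u w, adj u w -> 0 < c u w.
Hypothesis balance : forall u, x u = 0 -> \sum_(w | adj u w) c u w * x w = 0.

Lemma balance_white (st : state G) u :
    (forall v, st v = Black -> x v = 0) -> ~~ is_white st u ->
  \sum_(w in white_nbhd st u) c u w * x w = 0.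
Proof.
move=> x0 bu; have xu : x u = 0 by apply: x0; move: bu; rewrite /is_white; case: (st u).
rewrite -[RHS](balance xu) [RHS](bigID (is_white st)) /= [X in _ = _ + X]big1; last first.
  move=> w /andP[_]; rewrite /is_white; case e: (st w) => // _.
  by rewrite x0 // mulr0.
by rewrite addr0; apply: eq_bigl => w; rewrite inE andbC.
Qed.

Lemma compatible_blacken (st : state G) (W : {set G}) :
  compatible x st -> {in W, forall w, x w = 0} -> compatible x (blacken st W).
Proof.
move=> [e x0 xm] xW; exists e => [v|v s].
  by rewrite ffunE; case: ifP => [/xW|_ /x0].
by rewrite /marker ffunE; case: ifP => // _ /xm.
Qed.

(** Each of rules (a) to (c) reads off the balance equation at [u]: a lone term is zero, terms of
    one weak sign with sum zero all vanish, and a last term has the sign opposite to the others. *)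
Lemma compatible_move st st' :
  move (@P_Z G) st st' -> compatible x st -> compatible x st'.
Proof.
case=> [u w|u s|u s w p|w].
- rewrite may_force_PZ W_all_PZ => bu Ww xst; apply: compatible_blacken => //.
  move=> _ /set1P ->; case: xst => e x0 _.
  have := balance_white x0 bu; rewrite Ww big_set1 => /eqP.
  have uw : adj u w by have := set11 w; rewrite -Ww inE => /andP[].
  by rewrite mulf_eq0 gt_eqF ?c_gt0 //= => /eqP.
- rewrite may_force_PZ W_sign_PZ W_all_PZ => bu Ws xst.
  apply: compatible_blacken => // w wW; case: xst => e x0 xm.
  (* Multiplying by [d] makes all terms of the balance equation nonnegative. *)
  pose d : R := sgn_val e * sgn_val (iota_sign s).
  have d0 : d != 0.
    rewrite /d; case: e {xm d}; case: s {Ws} => /=;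
      by rewrite ?mulrN ?mulNr ?mulr1 ?oppr_eq0 oner_eq0.
  have ge0 v : v \in white_nbhd st u -> 0 <= c u v * (d * x v).
    move=> vW; have uv : adj u v by move: vW; rewrite inE => /andP[].
    apply: mulr_ge0; first by rewrite ltW ?c_gt0.
    apply: xm.
    by move: vW; rewrite -Ws inE => /andP[_ /eqP].
  move: d d0 ge0 => d d0 ge0.
  have: \sum_(v in white_nbhd st u) c u v * (d * x v) = 0.
    rewrite -[RHS](mulr0 d) -[in RHS](balance_white x0 bu) mulr_sumr.
    by apply: eq_bigr => v _; rewrite mulrCA.
  move/eqP; rewrite psumr_eq0 // => /allP /(_ w (mem_index_enum _)).
  rewrite wW /= !mulf_eq0 (negPf d0) /= gt_eqF => [/eqP //|].
  by apply: c_gt0; move: wW; rewrite inE => /andP[].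
- rewrite may_force_PZ !W_sign_PZ => bu _ Wi Wst Puw [e x0 xm].
  have uw : adj u w.
    by have := entry_sign_PZ u w; rewrite Puw; case: adj.
  have -> : p = Minus by have := entry_sign_PZ u w; rewrite Puw uw => -[].
  have -> : mul_sign Minus (iota_sign s) = s by case: (s).
  exists e => [v|v t]; rewrite /marker ffunE; first by case: eqP => // _ /x0.
  case: eqP => [-> [<-] {t}|_ /xm //].
  have wW : w \in white_nbhd st u.
    by have := set11 w; rewrite -Wst inE W_all_PZ => /andP[].
  (* The term of [w] is minus the sum of the others, which all carry [iota_sign s]; so the new
     marker [s] is right. *)
  have := balance_white x0 bu; rewrite (bigD1 w) //= => /eqP.
  rewrite addr_eq0 => /eqP cxw.
  rewrite -(pmulr_rge0 _ (c_gt0 uw)) mulrCA cxw mulrN mulr_sumr -sumrN.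
  apply: sumr_ge0 => y /andP[yW nyw].
  rewrite mulrCA -mulrN; apply: mulr_ge0.
    by apply/ltW/c_gt0; move: yW; rewrite inE => /andP[].
  rewrite -mulNr -mulrN -sgn_val_iota; apply: xm.
  have : y \notin W_star (@P_Z G) st u by rewrite Wst inE.
  have : y \notin [set w0 in white_nbhd st u | marker st w0 == Some (iota_sign (iota_sign s))].
    by rewrite Wi inE.
  rewrite [y \in W_star _ _ _]inE inE W_all_PZ yW /=.
  by case: (marker st y) => [[]|]; case: s {Wi}.
- move=> m0 ww [_ x0 _].
  (* No marker constrains the global sign yet, so it is chosen to make [Plus] correct at [w]. *)
  exists (if 0 <= x w then Plus else Minus) => [v|v s]; rewrite /marker ffunE.
    by case: eqP => // _ /x0.
  case: eqP => [-> [<-] /=|_ mv]; last by have := m0 v; rewrite /marker mv.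
  by rewrite mulr1; case: (lerP 0 (x w)) => h /=; rewrite ?mul1r // mulN1r oppr_ge0 ltW.
Qed.

Lemma forcing_vanish (S : {set G}) :
    signed_zero_forcing (@P_Z G) S -> {in S, forall v, x v = 0} ->
  forall v, x v = 0.
Proof.
move=> [st reach bst] xS.
suff [e x0 _] : compatible x st by move=> v; apply: x0.
have: compatible x (init S).
  exists Plus => v; rewrite /marker ffunE; first by case: ifP => // /xS.
  by case: ifP.
elim: reach => {st bst} [st st' /compatible_move //|//|st1 st2 st3 _ IH1 _ IH2 /IH1/IH2 //].
Qed.

End NullityBound.

(** * Nullity is at most the size of a forcing set *)

Section Nullity.
Local Open Scope ring_scope.

(** [kermx D] consists of the vectors vanishing on [I] and has dimension at least [N - #|I|]. It
    meets the kernel of [A] trivially, so the two dimensions add up to at most [N]. *)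
Lemma nullity_le_vanishing (F : fieldType) (N : nat) (A : 'M[F]_N) (I : {set 'I_N}) :
    (forall v : 'rV_N, v *m A = 0 -> {in I, forall i, v 0 i = 0} -> v = 0) ->
  (\rank (kermx A) <= #|I|)%N.
Proof.
move=> vanish; pose D : 'M[F]_(N, #|I|) := \matrix_(i, k) (i == enum_val k)%:R.
have cap0 : \rank (kermx A :&: kermx D) = 0%N.
  apply/eqP; rewrite mxrank_eq0; apply/rowV0P => v.
  rewrite sub_capmx => /andP[/sub_kermxP vA /sub_kermxP vD].
  apply: vanish => // i iI; move/matrixP: vD => /(_ 0 (enum_rank_in iI i)).
  rewrite !mxE (bigD1 i) //= big1 => [|j /negPf ji]; rewrite mxE enum_rankK_in //.
    by rewrite eqxx mulr1 addr0.
  by rewrite ji mulr0.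
have := mxrank_sum_cap (kermx A) (kermx D); rewrite cap0 addn0 => e.
have := rank_leq_col (kermx A + kermx D)%MS; rewrite e [\rank (kermx D)]mxrank_ker.
rewrite addnBA ?rank_leq_row // leq_subLR leq_add2r => /leq_trans -> //.
exact: rank_leq_col.
Qed.

Lemma nullity_le_forcing (R : realType) (G : sgraph) (A : 'M[R]_#|G|) (S : {set G}) :
    in_Z A -> has_graph A -> signed_zero_forcing (@P_Z G) S ->
  (nullity A <= #|S|)%N.
Proof.
move=> [symA signA] grA forceS.
rewrite -(card_imset S (@enum_rank_inj G)); apply: nullity_le_vanishing => v vA vS.
(* [d] is the global sign that makes the nonzero off-diagonal entries positive. *)
have [d dA] : exists d : R, forall i j, i != j -> A i j != 0 -> 0 < d * A i j.
  case: signA => sA; [exists 1 | exists (-1)] => i j ij nz.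
    by rewrite mul1r lt_neqAle eq_sym nz sA.
  by rewrite mulN1r oppr_gt0 lt_neqAle nz sA.
have adjA u w : adj u w -> enum_rank u != enum_rank w /\ A (enum_rank u) (enum_rank w) != 0.
  move=> uw; have nuw : enum_rank u != enum_rank w.
    by apply: contraTneq uw => /enum_rank_inj ->; rewrite adj_irr.
  by rewrite grA // !enum_rankK.
pose x w := v 0 (enum_rank w).
have x0 : forall w, x w = 0.
  apply: (@forcing_vanish R G x (fun u w => d * A (enum_rank u) (enum_rank w)) _ _ S) => //.
  - by move=> u w /adjA[nuw nz]; apply: dA.
  - move=> u xu; move/matrixP: vA => /(_ 0 (enum_rank u)); rewrite !mxE => vAu.
    rewrite -[RHS](mulr0 d) -[in RHS]vAu mulr_sumr.
    rewrite (reindex (@enum_rank G)) /=; last exact/onW_bij/enum_rank_bij.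
    rewrite [RHS](bigID (adj u)) /= [X in _ = _ + X]big1 => [|w nuw].
      rewrite addr0; apply: eq_bigr => w _.
      by rewrite -[in LHS]symA mxE /x -mulrA (mulrC (A _ _)).
    (* Outside the neighbours of [u], the diagonal term dies with [x u] and the other entries are
       zero. *)
    have [->|nwu] := eqVneq w u; first by rewrite -/(x u) xu mul0r mulr0.
    have: ~~ (A (enum_rank w) (enum_rank u) != 0).
      by rewrite grA ?(inj_eq enum_rank_inj) // !enum_rankK adj_sym.
    by rewrite negbK => /eqP ->; rewrite !mulr0.
  - by move=> w wS; apply: vS; apply: imset_f.
by apply/rowP => i; rewrite mxE -(enum_valK i); apply: x0.
Qed.

Lemma M_Z_le_Z_pm (R : realType) (G : sgraph) : (M_Z R G <= Z_pm G)%N.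
Proof.
rewrite /M_Z /Z_pm /Z_pm_pattern.
case: ex_maxnP => k /asboolP[A [ZA grA <-]] _.
case: ex_minnP => l /asboolP[S fS <-] _.
exact: nullity_le_forcing.
Qed.

End Nullity.

(** * The line graph of the complete graph and its Gram matrix *)

Section LineKn.
Variable n : nat.
Local Notation L := (line_graph (complete_graph n)).

Lemma edge_set_complete : edge_set (complete_graph n) = [set e : {set 'I_n} | #|e| == 2].
Proof.
apply/setP => e; rewrite !inE.
apply/existsP/cards2P => [[i /existsP[j /andP[ij /eqP->]]]|[i [j [ij ->]]]].
  by exists i, j.
by exists i; apply/existsP; exists j; rewrite eqxx andbT.
Qed.

Lemma card_line_complete : #|L| = 'C(n, 2).
Proof.
rewrite card_sig -[n in 'C(n, _)]card_ord -card_draws edge_set_complete.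
by apply: eq_card => e.
Qed.

Lemma pair_edge (i j : 'I_n) : i != j -> [set i; j] \in edge_set (complete_graph n).
Proof. by move=> ij; rewrite edge_set_complete inE cards2 ij. Qed.

Definition edge (i j : 'I_n) (ij : i != j) : L := Sub [set i; j] (pair_edge ij).

Lemma M_Z_line_complete (R : realType) : 'C(n, 2) - n <= M_Z R L.
Proof.
pose B : 'M[R]_(n, #|L|) := (\matrix_(v < n, e < #|L|) (v \in val (enum_val e : L))%:R)%R.
pose A := (B^T *m B)%R.
(* Entries count common endpoints, so off the diagonal they are nonzero exactly when the edges
   meet. *)
have AE i j : A i j = #|val (enum_val i) :&: val (enum_val j)|%:R%R.
  rewrite !mxE (eq_bigr (fun v => (v \in val (enum_val i) :&: val (enum_val j))%:R%R)).
    by rewrite -natr_sum -sum1_card [in RHS]big_mkcond.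
  by move=> v _; rewrite !mxE -natrM mulnb inE.
rewrite /M_Z; case: ex_maxnP => k _ max_k.
have rA : \rank A <= n by rewrite (leq_trans (mxrankM_maxr _ _)) ?rank_leq_row.
apply: leq_trans (max_k (nullity A) _).
  by rewrite /nullity mxrank_ker -card_line_complete leq_sub2l.
apply/asboolP; exists A; split=> //.
  split; first by rewrite trmx_mul trmxK.
  by left=> i j _; rewrite AE ler0n.
move=> i j ij; rewrite AE pnatr_eq0 cards_eq0 /=.
by rewrite /line_adj (inj_eq enum_val_inj) ij.
Qed.

End LineKn.

(** * A forcing set whose complement has [n] edges *)

Section StarForcing.
Variable m : nat.
Local Notation n := m.+4.+2.
Local Notation L := (line_graph (complete_graph n)).
Local Notation vtx k := (@Ordinal m.+4.+2 k isT).
Implicit Types (u : L) (i j k l : 'I_n) (K W : {set 'I_n}).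

(** The white edges are indexed by vertices: [k] stands for the edge 0k, and the index 0, free since
    00 is no edge, stands for 12. *)
Definition white_ends k : 'I_n * 'I_n :=
  if k == vtx 0 then (vtx 1, vtx 2) else (vtx 0, k).

Lemma white_endsP k : (white_ends k).1 != (white_ends k).2.
Proof. by rewrite /white_ends; case: (eqVneq k (vtx 0)) => [_|k0] //; rewrite eq_sym. Qed.

Definition white_edge k : L := edge (white_endsP k).

Lemma val_white_edge k :
  val (white_edge k) = if k == vtx 0 then [set vtx 1; vtx 2] else [set vtx 0; k].
Proof. by rewrite /= /white_ends; case: eqP. Qed.

Lemma white_edge_inj : injective white_edge.
Proof.
move=> k l /(congr1 val); rewrite !val_white_edge.
case: (eqVneq k (vtx 0)) => [->|k0]; case: (eqVneq l (vtx 0)) => [->|l0] //= /setP e.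
- by have := e (vtx 0); rewrite !inE eqxx.
- by have := e (vtx 0); rewrite !inE eqxx.
- by have := e k; rewrite !inE (negPf k0) eqxx => /esym/eqP.
Qed.

(** [K] holds the indices of the edges still white, so forcing shrinks [K]. *)
Definition blacks K : {set L} := ~: (white_edge @: K).

Lemma white_edge_blacks K k : (white_edge k \in blacks K) = (k \notin K).
Proof. by rewrite inE mem_imset //; apply: white_edge_inj. Qed.

Lemma edge_blacks K i j (ij : i != j) : 2 < i -> 0 < j -> edge ij \in blacks K.
Proof.
move=> i2 j0; rewrite inE; apply/imsetP => -[k _ /(congr1 val)].
rewrite val_white_edge /= => /setP e; move: (e i) (e (vtx 0)); rewrite !inE eqxx /=.
case: eqP => _; rewrite !inE.
  by move/esym/orP => [] /eqP h; rewrite h in i2.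
by rewrite eqxx => _ /orP[]/eqP h; [rewrite -h in i2|rewrite -h in j0].
Qed.

(** Also true when [e] is [white_edge k] itself; for black [e] and white [white_edge k] this cannot
    occur, and [meets] is adjacency. *)
Definition meets (e : L) k : bool :=
  if k == vtx 0 then (vtx 1 \in val e) || (vtx 2 \in val e)
  else (vtx 0 \in val e) || (k \in val e).

(** Moves the game to indices: white neighbourhoods become subsets of [K]. *)
Lemma nbhd_blacks K u : u \in blacks K ->
  [set v | adj u v] :\: blacks K = white_edge @: [set k in K | meets u k].
Proof.
have adjE k : line_adj u (white_edge k) = (u != white_edge k) && meets u k.
  rewrite /line_adj val_white_edge /meets; congr (_ && _).
  have meet2 (x y : 'I_n) (e : {set 'I_n}) : (e :&: [set x; y] != set0) = (x \in e) || (y \in e).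
    apply/set0Pn/orP => [[z /setIP[ze /set2P[] <-]]|[] h]; rewrite ?ze; try by [left|right].
      by exists x; rewrite !inE h eqxx.
    by exists y; rewrite !inE h eqxx orbT.
  by case: (eqVneq k (vtx 0)) => _; rewrite meet2.
move=> uK; apply/setP => v; rewrite !inE negbK; apply/andP/imsetP.
  by case=> /imsetP[k kK ->]; rewrite /= adjE => /andP[_ ?]; exists k; rewrite // inE kK.
case=> k; rewrite inE => /andP[kK mk] ->; rewrite imset_f //= adjE mk andbT.
by split=> //; apply: contraTneq uK => ->; rewrite white_edge_blacks kK.
Qed.

Lemma blacks_setD K W : (white_edge @: W) :|: blacks K = blacks (K :\: W).
Proof.
rewrite /blacks; apply/setP => v; rewrite !inE.
(* Edges outside the image of [white_edge] are black on both sides. *)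
case: (boolP (v \in white_edge @: setT)) => [/imsetP[k _ ->]|/imsetP nv].
  rewrite !(mem_imset _ _ white_edge_inj) inE negb_and negbK.
  by case: (_ \in W).
have nI X : (v \in white_edge @: X) = false.
  by apply/imsetP => -[k _ e]; apply: nv; exists k.
by rewrite !nI.
Qed.

Lemma reach_single K u k :
    u \in blacks K -> [set l in K | meets u l] = [set k] ->
  szf_reach (blacks K) (blacks (K :\ k)).
Proof.
move=> uK e; rewrite -blacks_setD imset_set1.
by apply: (szf_reach_single uK); rewrite nbhd_blacks // e imset_set1.
Qed.

Lemma reach_triple K a b c uab uac ubc :
    a != b -> a != c -> b != c ->
    uab \in blacks K -> uac \in blacks K -> ubc \in blacks K ->
    [set l in K | meets uab l] = [set a; b] ->
    [set l in K | meets uac l] = [set a; c] ->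
    [set l in K | meets ubc l] = [set b; c] ->
  szf_reach (blacks K) (blacks (K :\: [set a; b; c])).
Proof.
move=> ab ac bc uabK uacK ubcK eab eac ebc.
rewrite -blacks_setD !imsetU !imset_set1.
by apply: (szf_reach_triple _ _ _ uabK uacK ubcK);
  rewrite ?(inj_eq white_edge_inj) ?nbhd_blacks // ?eab ?eac ?ebc imsetU !imset_set1.
Qed.

(** With 04 black, the edge 4k sees only 0k among the white edges, so the indices [k >= 3] leave [K]
    one at a time. The induction is on the number of white edges. *)
Lemma reach_pendant K : vtx 4 \notin K ->
  szf_reach (blacks K) (blacks (K :&: [set k : 'I_n | k < 3])).
Proof.
have [c] := ubnP #|K|; elim: c K => // c IH K; rewrite ltnS => Kc K4.
have [/subsetP sub|/subsetPn[k kK]] := boolP (K \subset [set k : 'I_n | k < 3]).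
  by rewrite (setIidPl _); [apply: rt_refl|apply/subsetP].
rewrite inE -leqNgt => k3.
have k4 : vtx 4 != k by apply: contraNneq K4 => ->.
have -> : K :&: [set k : 'I_n | k < 3] = (K :\ k) :&: [set k : 'I_n | k < 3].
  apply/setP => l; rewrite !inE; case: eqP => // ->.
  by rewrite ltnNge k3 andbF.
apply: (rt_trans _ _ _ (init (blacks (K :\ k)))); last first.
  apply: IH; last by rewrite !inE (negPf K4) andbF.
  by apply: leq_trans Kc; rewrite (cardsD1 k K) kK.
apply: (@reach_single _ (edge k4)) => //.
  by apply: edge_blacks => //; apply: ltn_trans k3.
apply/setP => l; rewrite !inE /meets !inE /=.
have nk (x : 'I_n) : x < 3 -> (x == k) = false.
  by move=> x3; apply/eqP => xk; move: x3; rewrite xk ltnNge k3.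
case: eqP => [->|_]; first by rewrite !nk // andbF.
rewrite (nk (vtx 0)) //=; have [->|_] /= := eqVneq l (vtx 4).
  by rewrite (negPf K4) (negPf k4).
by case: eqP => [->|]; rewrite ?kK ?andbF.
Qed.

Lemma star_forcing : signed_zero_forcing (@P_Z L) (blacks setT).
Proof.
apply: szf_reach_setT.
(* The vertex 5 exists because [n] is at least 6. *)
apply: (rt_trans _ _ _ (init (blacks (setT :\: [set vtx 3; vtx 4; vtx 5])))).
  have e34 : vtx 3 != vtx 4 by []. have e35 : vtx 3 != vtx 5 by [].
  have e45 : vtx 4 != vtx 5 by [].
  apply: (@reach_triple _ _ _ _ (edge e34) (edge e35) (edge e45)) => //;
    try exact: edge_blacks;
    by apply/setP => l; rewrite !inE /meets !inE; case: (eqVneq l (vtx 0)) => [->|].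
set K := setT :\: _.
have K4 : vtx 4 \notin K by rewrite !inE eqxx orbT.
apply: (rt_trans _ _ _ _ _ (reach_pendant K4)).
set K' := K :&: _.
(* The remaining indices 0, 1, 2 stand for the triangle 12, 01, 02. *)
have K'E l : (l \in K') = (l < 3).
  rewrite !inE andbT; case: (ltnP l 3) => l3; rewrite ?andbF // andbT.
  by apply/negP => /orP[/orP[]|] /eqP h; rewrite h in l3.
have e31 : vtx 3 != vtx 1 by []. have e32 : vtx 3 != vtx 2 by [].
have -> : setT = blacks (K' :\: [set vtx 1; vtx 2; vtx 0]).
  suff -> : K' :\: [set vtx 1; vtx 2; vtx 0] = set0 by rewrite /blacks imset0 setC0.
  apply/setP => l; rewrite inE K'E !inE; apply/negP => /andP[].
  by case: l => -[|[|[|l]]] i.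
(* The edge 03 sees 01 and 02, the edge 31 sees 01 and 12, and 32 sees 02 and 12. *)
have u3 : white_edge (vtx 3) \in blacks K' by rewrite white_edge_blacks K'E.
apply: (@reach_triple _ _ _ _ (white_edge (vtx 3)) (edge e31) (edge e32)) => //;
  try exact: edge_blacks;
  apply/setP => l; rewrite inE K'E /meets ?val_white_edge !inE /=.
all: by case: l => -[|[|[|l]]] i.
Qed.

Lemma Z_pm_line_complete : Z_pm L <= 'C(n, 2) - n.
Proof.
rewrite /Z_pm /Z_pm_pattern; case: ex_minnP => k _; apply.
apply/asboolP; exists (blacks setT); first exact: star_forcing.
rewrite cardsCs setCK card_line_complete card_imset ?cardsT ?card_ord //.
exact: white_edge_inj.
Qed.

End StarForcing.

Theorem mainTheorem6 (R : realType) (n : nat) (hn : 6 <= n) :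
  M_Z R (line_graph (complete_graph n)) = Z_pm (line_graph (complete_graph n)) /\
  Z_pm (line_graph (complete_graph n)) = 'C(n, 2) - n.
Proof.
have ub : Z_pm (line_graph (complete_graph n)) <= 'C(n, 2) - n.
  by move: hn; case: n => [|[|[|[|[|[|m]]]]]] // _; apply: Z_pm_line_complete.
have lb := M_Z_line_complete n R.
have le := M_Z_le_Z_pm R (line_graph (complete_graph n)).
(* The lower bound on [M_Z], the inequality [M_Z <= Z_pm] and the forcing set close a cycle of
   inequalities. *)
have eZ : Z_pm (line_graph (complete_graph n)) = 'C(n, 2) - n.
  by apply/eqP; rewrite eqn_leq ub (leq_trans lb).
by split=> //; apply/eqP; rewrite eqn_leq le eZ lb.
Qed.
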